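(* Let $X$ be a real Hilbert space, let $U,V$ be two closed linear subspaces of $X$, let $\beta\in(0,1)$, and set $$T := \big((1-\beta)\operatorname{Id}+\beta R_V\big)P_U .$$ Suppose that $U\subsetneqq X$ and $U\not\subseteq V$. Then $$\kappa(T) = \frac{1+2\beta(1-c_F^2)+\sqrt{(1-2\beta)^2+4(1-\beta)\beta c_F^2}}{2(2-\beta c_F^2)},$$ where $c_F := c_F(U,V)$ denotes the cosine of the Friedrichs angle between $U$ and $V$.
   Context: $X$ is a real Hilbert space with inner product $\langle\cdot,\cdot\rangle$ and induced norm $\|\cdot\|$; $\operatorname{Id}$ is the identity operator on $X$. A map $T\colon X\to X$ is nonexpansive if $\|Tx-Ty\|\le\|x-y\|$ for all $x,y\in X$. For $\kappa\in[0,1]$, $T$ is called $\kappa$-averaged if there is a nonexpansive $N\colon X\to X$ with $T=(1-\kappa)\operatorname{Id}+\kappa N$. For a nonexpansive $T\colon X\to X$, the modulus of averagedness is $\kappa(T):=\min\{\kappa\in[0,1] : T \text{ is } \kappa\text{-averaged}\}$ (the minimum is attained). For a closed linear subspace $V$ of $X$, $P_V$ is the orthogonal projection onto $V$, $V^\perp$ is the orthogonal complement, and $R_V:=P_V-P_{V^\perp}$ is the reflector. The cosine of the Friedrichs angle between closed linear subspaces $U,V$ of $X$ is $$c_F(U,V):=\sup\{\langle u,v\rangle : u\in U\cap(U\cap V)^\perp,\ v\in V\cap(U\cap V)^\perp,\ \|u\|\le 1,\ \|v\|\le 1\}.$$ *)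

(* Defs.v *)
From HB Require Import structures.
From mathcomp Require Import all_boot all_order all_algebra.
From mathcomp Require Import all_classical all_reals all_analysis.

Set Implicit Arguments.
Unset Strict Implicit.
Unset Printing Implicit Defensive.

Import Order.TTheory GRing.Theory Num.Theory.
Import numFieldNormedType.Exports.

Local Open Scope classical_set_scope.
Local Open Scope ring_scope.

(* A real Hilbert space is given by X : completeNormedModType R together with
   a positive definite symmetric bilinear form ip : {dot X for idfun} that
   induces the norm. *)
Definition induces_norm (R : realType) (X : normedModType R)
    (ip : {dot X for idfun}) : Prop :=
  forall x : X, `|x| = Num.sqrt (ip x x).

Definition closed_subspace (R : realType) (X : normedModType R)
    (V : set X) : Prop :=
  submod_closed (mem V) /\ closed V.

(* The default 0 is returned when A has no least element. *)
Definition minimum (R : realType) (A : set R) : R :=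
  xget 0 (A `&` lbound A).

Section Averagedness.
Variables (R : realType) (X : normedModType R).

Definition nonexpansive (T : X -> X) : Prop :=
  forall x y : X, `|T x - T y| <= `|x - y|.

Definition averaged (kappa : R) (T : X -> X) : Prop :=
  exists N : X -> X, nonexpansive N /\
    T = (fun x => (1 - kappa) *: x + kappa *: N x).

Definition modulus_averagedness (T : X -> X) : R :=
  minimum [set kappa : R | 0 <= kappa <= 1 /\ averaged kappa T].

End Averagedness.

Section Hilbert.
Variables (R : realType) (X : normedModType R) (ip : {dot X for idfun}).

Definition orthocompl (V : set X) : set X :=
  [set x | forall v, V v -> ip x v = 0].

(* P_V x is the point p of V such that x - p is orthogonal to V; it exists
   and is unique when V is a closed subspace of a Hilbert space. *)
Definition orthoproj (V : set X) (x : X) : X :=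
  xget 0 [set p | V p /\ orthocompl V (x - p)].

Definition reflector (V : set X) (x : X) : X :=
  orthoproj V x - orthoproj (orthocompl V) x.

Definition cos_friedrichs (U V : set X) : R :=
  let W := orthocompl (U `&` V) in
  sup [set ip u v | u in [set u | (U `&` W) u /\ `|u| <= 1]
                  & v in [set v | (V `&` W) v /\ `|v| <= 1]].

End Hilbert.

(* Main.v *)
(* Write x = y + w with y = P_U x, w orthogonal to U, and let q = y - P_V y, so
   that T x = y - 2 beta q. For linear T, kappa-averagedness means
   |T x - (1 - kappa) x| <= kappa |x| for all x, which here reads
     4 beta (1 - kappa) <w, q>
       <= (2 kappa - 1) |w|^2 + 4 beta (kappa - beta) |q|^2.
   The best constant k in |<w, q>| <= k |w| |q| is c_F, so the condition becomes
   kappa >= 1/2, kappa >= beta and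
   beta c_F^2 (1 - kappa)^2 <= (kappa - beta) (2 kappa - 1), that is, kappa is at
   least the larger root of a quadratic. That k cannot be smaller than c_F uses a
   duality: a bound k for the pair (w, q) gives the Friedrichs bound k for
   (U^perp, V^perp) by density, hence the bound k for the analogous pair of
   (U^perp, V^perp), hence the Friedrichs bound k for (U, V). *)
Require Import Defs.
From HB Require Import structures.
From mathcomp Require Import all_boot all_order all_algebra.
From mathcomp Require Import all_classical all_reals all_analysis.
From mathcomp Require Import ring lra.

Set Implicit Arguments.
Unset Strict Implicit.
Unset Printing Implicit Defensive.

Import Order.TTheory GRing.Theory Num.Theory.
Import numFieldNormedType.Exports.

Local Open Scope classical_set_scope.
Local Open Scope ring_scope.

(** * Calculus of the inner product and the Cauchy-Schwarz inequality *)

Section InnerProduct.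
Variables (R : realType) (X : normedModType R) (ip : {dot X for idfun}).
Hypothesis ip_norm : induces_norm ip.
Implicit Types (x y z : X) (a : R).

Lemma ipC x y : ip x y = ip y x.
Proof. by rewrite hermC /= expr0 mul1r. Qed.

Lemma ipDl x y z : ip (x + y) z = ip x z + ip y z.
Proof. exact: linearDl. Qed.

Lemma ipBl x y z : ip (x - y) z = ip x z - ip y z.
Proof. exact: linearBl. Qed.

Lemma ipZl a x z : ip (a *: x) z = a * ip x z.
Proof. exact: linearZl_LR. Qed.

Lemma ip0l z : ip 0 z = 0.
Proof. exact: linear0l. Qed.

Lemma ipNl x z : ip (- x) z = - ip x z.
Proof. exact: linearNl. Qed.

Lemma ipDr x y z : ip z (x + y) = ip z x + ip z y.
Proof. exact: linearDr. Qed.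

Lemma ipBr x y z : ip z (x - y) = ip z x - ip z y.
Proof. exact: linearBr. Qed.

Lemma ipZr a x z : ip z (a *: x) = a * ip z x.
Proof. exact: linearZr_LR. Qed.

Lemma ip0r z : ip z 0 = 0.
Proof. exact: linear0r. Qed.

Lemma ipNr x z : ip z (- x) = - ip z x.
Proof. exact: linearNr. Qed.

Definition ipE := (ipDl, ipBl, ipZl, ipNl, ip0l, ipDr, ipBr, ipZr, ipNr, ip0r).

Lemma ip_ge0 x : 0 <= ip x x.
Proof.
have [->|x0] := eqVneq x 0; first by rewrite ip0l.
by apply: ltW; apply: neq0_dnorm_gt0.
Qed.

Lemma ipxx x : ip x x = `|x| ^+ 2.
Proof. by rewrite ip_norm sqr_sqrtr // ip_ge0. Qed.

Lemma CauchySchwarz_norm x y : `|ip x y| <= `|x| * `|y|.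
Proof.
have [->|y0] := eqVneq y 0; first by rewrite ip0r !normr0 mulr0.
rewrite -(ler_pXn2r (n := 2)) ?nnegrE ?mulr_ge0 // real_normK ?num_real//.
have y2 : 0 < ip y y by rewrite ipxx exprn_gt0 // normr_gt0.
(* This square equals <y,y> (<x,x> <y,y> - <x,y>^2), and the factor <y,y> > 0 cancels. *)
have := ip_ge0 (ip y y *: x - ip x y *: y).
rewrite !ipE (ipC y x) exprMn -!ipxx => h.
rewrite -subr_ge0 -(pmulr_rge0 _ y2); apply: le_trans h _.
by rewrite le_eqVlt; apply/orP; left; apply/eqP; ring.
Qed.

End InnerProduct.

(** * Closed subspaces, and closures described by norm distance *)

Section ClosedSubspace.
Variables (R : realType) (X : normedModType R).
Implicit Types (V : set X).

Lemma closed_subspace0 V : closed_subspace V -> V 0.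
Proof. by case=> -[/set_mem]. Qed.

Lemma closed_subspaceZD V a x y : closed_subspace V -> V x -> V y -> V (a *: x + y).
Proof. by case=> -[_ h] _ Vx Vy; apply: set_mem; apply: h; exact: mem_set. Qed.

Lemma closed_subspaceZ V a x : closed_subspace V -> V x -> V (a *: x).
Proof.
move=> sV Vx; rewrite -[_ *: _]addr0.
by apply: closed_subspaceZD => //; exact: closed_subspace0.
Qed.

Lemma closed_subspaceB V x y : closed_subspace V -> V x -> V y -> V (x - y).
Proof.
by move=> sV Vx Vy; rewrite addrC -scaleN1r; exact: closed_subspaceZD.
Qed.

Lemma closure_normP V x :
  closure V x <-> forall e, 0 < e -> exists2 v, V v & `|x - v| < e.
Proof.
split=> [+ e e0|h B].
  move=> /(_ (ball x e)) []; first exact: nbhsx_ballx.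
  by move=> v [Vv]; rewrite -ball_normE /=; exists v.
move=> /nbhs_ballP [e /= e0 eB]; have [v Vv xv] := h e e0.
by exists v; split=> //; apply: eB; rewrite -ball_normE.
Qed.

Lemma closed_subspace_intro V :
  V 0 -> (forall a x y, V x -> V y -> V (a *: x + y)) ->
  (forall x, (forall e, 0 < e -> exists2 v, V v & `|x - v| < e) -> V x) ->
  closed_subspace V.
Proof.
move=> V0 VP Vc; split; last by move=> x /closure_normP; exact: Vc.
split; first exact: mem_set.
by move=> a x y /set_mem Vx /set_mem Vy; apply: mem_set; exact: VP.
Qed.

Lemma closed_subspace_closure V :
  V 0 -> (forall a x y, V x -> V y -> V (a *: x + y)) ->
  closed_subspace (closure V).
Proof.
move=> V0 VP; apply: closed_subspace_intro.
- exact: subset_closure.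
- move=> a x y /closure_normP hx /closure_normP hy; apply/closure_normP => e e0.
  (* The added 1 keeps the divisor positive when [a] is 0. *)
  have a0 : 0 < `|a| + 1 by rewrite ltr_wpDl.
  have [x' Vx' xx'] := hx (e / 2 / (`|a| + 1)) (divr_gt0 (divr_gt0 e0 (ltr0Sn _ _)) a0).
  have [y' Vy' yy'] := hy (e / 2) (divr_gt0 e0 (ltr0Sn _ _)).
  exists (a *: x' + y'); first exact: VP.
  rewrite opprD addrACA -scalerBr (splitr e).
  apply: le_lt_trans (ler_normD _ _) _; rewrite normrZ ltr_leD //; last exact: ltW.
  move: xx'; rewrite ltr_pdivlMr // mulrC; apply: le_lt_trans.
  by rewrite ler_wpM2r // lerDl.
- by move=> x /closure_normP; exact: closed_closure.
Qed.

Lemma closed_subspaceI U V :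
  closed_subspace U -> closed_subspace V -> closed_subspace (U `&` V).
Proof.
move=> sU sV; split; last by apply: closedI; [case: sU|case: sV].
split; first by apply: mem_set; split; exact: closed_subspace0.
move=> a x y /set_mem[Ux Vx] /set_mem[Uy Vy].
by apply: mem_set; split; exact: closed_subspaceZD.
Qed.

End ClosedSubspace.

(** * Orthogonal complements and the projection theorem *)

Section OrthogonalProjection.
Variables (R : realType) (X : completeNormedModType R) (ip : {dot X for idfun}).
Hypothesis ip_norm : induces_norm ip.
Implicit Types (V : set X) (x y v : X).
Local Notation "V ^!" := (orthocompl ip V).

(** Closedness comes from Cauchy-Schwarz: if x' is orthogonal to v, then |<x,v>| = |<x - x',v>| <=
    |x - x'| |v|. *)
Lemma closed_subspace_orthocompl V : closed_subspace V^!.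
Proof.
apply: closed_subspace_intro => [v _|a x y hx hy v Vv|x h v Vv].
- exact: ip0l.
- by rewrite !ipE hx // hy // mulr0 addr0.
- apply/eqP; rewrite -normr_le0; apply/ler_addgt0Pl => e e0.
  have v0 : 0 < `|v| + 1 by rewrite ltr_wpDl.
  have [x' /(_ _ Vv) x'v xx'] := h _ (divr_gt0 e0 v0).
  rewrite addr0 -[ip x v]subr0 -x'v -ipBl.
  apply: le_trans (CauchySchwarz_norm ip_norm _ _) _.
  move: xx'; rewrite ltr_pdivlMr // => /ltW; apply: le_trans.
  by rewrite ler_wpM2l // lerDl.
Qed.

Lemma parallelogram x y :
  `|x + y| ^+ 2 + `|x - y| ^+ 2 = 2 * `|x| ^+ 2 + 2 * `|y| ^+ 2.
Proof. by rewrite -!(ipxx ip_norm) !ipE; ring. Qed.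

(** A minimizing sequence is Cauchy by the parallelogram law, because midpoints stay in V, at
    distance at least d from x. Completeness gives the limit and closedness keeps it in V. *)
Lemma closest_point_exists V x : closed_subspace V ->
  exists2 p, V p & forall v, V v -> `|x - p| <= `|x - v|.
Proof.
move=> sV; pose D := [set `|x - v| | v in V].
have hD : has_inf D.
  split; first by exists `|x - 0|, 0 => //; exact: closed_subspace0.
  by exists 0 => _ [v _ <-].
pose d := inf D.
have dle v : V v -> d <= `|x - v|.
  by move=> Vv; apply: ge_inf; [case: hD|exists v].
have d0 : 0 <= d by apply: lb_le_inf; [case: hD|move=> _ [v _ <-]].
have /choice[u uP] n : exists v, V v /\ `|x - v| < d + n.+1%:R^-1.
  have n0 : 0 < n.+1%:R^-1 :> R by rewrite invr_gt0.
  by have [_ [v Vv <-] ?] := inf_adherent n0 hD; exists v.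
have udist e : 0 < e -> \forall n \near \oo, `|x - u n| < d + e.
  move=> e0; near=> n; apply: lt_trans (uP n).2 _; rewrite ltrD2l.
  by near: n; exact: near_infty_natSinv_lt (PosNum e0).
have ucvg : cvg (u @ \oo).
  apply/cauchy_cvgP; apply/cauchy_exP => e e0.
  (* The parallelogram law will give |u_N - u_n|^2 <= 4 (d + del)^2 - 4 d^2 = del (8 d + 4 del),
     which is below e^2 because del <= 1 and del (8 d + 5) <= e^2. *)
  pose del := Num.min 1 (e ^+ 2 / (8 * d + 5)).
  have del0 : 0 < del by rewrite lt_min ltr01 divr_gt0 ?exprn_gt0//; lra.
  have [N _ hN] := udist _ del0.
  exists (u N); exists N => // n Nn; rewrite /= -ball_normE /=.
  have hN1 := hN N (leqnn N); have hn1 := hN n Nn.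
  have mid : d <= `|x - (2^-1 *: (u N) + 2^-1 *: (u n))|.
    apply: dle; apply: closed_subspaceZD => //; first exact: (uP N).1.
    exact: closed_subspaceZ (uP n).1.
  have par := parallelogram (x - u n) (x - u N).
  have e1 : (x - u n) - (x - u N) = u N - u n.
    by rewrite opprB addrC addrA subrK.
  have e2 : (x - u n) + (x - u N) = 2 *: (x - (2^-1 *: (u N) + 2^-1 *: (u n))).
    rewrite scalerBr scalerDr !scalerA divff ?pnatr_eq0 // !scale1r.
    by rewrite scaler_nat mulr2n opprD addrACA [- u N - _]addrC.
  rewrite e1 e2 normrZ ger0_norm // in par.
  rewrite -(ltr_pXn2r (n := 2)) ?nnegrE //; last exact: ltW.
  have del1 : del <= 1 by rewrite ge_min lexx.
  have del2 : del * (8 * d + 5) <= e ^+ 2.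
    by rewrite -ler_pdivlMr; [rewrite ge_min lexx orbT|lra].
  have s1 : `|x - u N| ^+ 2 <= (d + del) ^+ 2.
    by rewrite ler_pXn2r ?nnegrE //; [exact: ltW|lra].
  have s2 : `|x - u n| ^+ 2 <= (d + del) ^+ 2.
    by rewrite ler_pXn2r ?nnegrE //; [exact: ltW|lra].
  have s3 : d ^+ 2 <= `|x - (2^-1 *: (u N) + 2^-1 *: (u n))| ^+ 2.
    by rewrite ler_pXn2r ?nnegrE.
  nra.
have /cvg_ex[p pcvg] := ucvg.
have pN e : 0 < e -> \forall n \near \oo, `|p - u n| < e.
  by move=> e0; move/cvgr_dist_lt : pcvg; apply.
exists p.
  case: sV => _; apply; apply/closure_normP => e e0.
  have [N _ hN] := pN _ e0; exists (u N); first exact: (uP N).1.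
  exact: hN (leqnn N).
move=> v Vv; apply: le_trans (dle _ Vv).
apply/ler_addgt0Pr => e e0.
have e20 : 0 < e / 2 by rewrite divr_gt0.
have [n [h1 h2]] : exists n, `|p - u n| < e / 2 /\ `|x - u n| < d + e / 2.
  near \oo => n; exists n; split; near: n; [exact: pN|exact: udist].
apply: le_trans (ler_distD (u n) _ _) _; rewrite (distrC (u n)).
by apply: ltW; rewrite (splitr e) addrA; apply: ltrD.
Unshelve. all: by end_near.
Qed.

Lemma orthoproj_exists V x : closed_subspace V ->
  exists p, V p /\ V^! (x - p).
Proof.
move=> sV; have [p Vp hp] := closest_point_exists x sV.
exists p; split=> // v Vv.
have [->|v0] := eqVneq v 0; first by rewrite ip0r.
have v2 : 0 < ip v v by rewrite (ipxx ip_norm) exprn_gt0 // normr_gt0.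
(* Moving p along v by the optimal step lowers the squared distance by <x - p,v>^2 / <v,v>, so
   minimality forces <x - p,v> = 0. *)
have := hp _ (closed_subspaceZD (ip (x - p) v / ip v v) sV Vv Vp).
rewrite -(ler_pXn2r (n := 2)) ?nnegrE // -!(ipxx ip_norm).
rewrite [in X in _ <= X](_ : x - _ = x - p - ip (x - p) v / ip v v *: v); last first.
  by rewrite opprD addrCA addrC.
move: (x - p) => r; rewrite !(ipBl, ipZl) !(ipBr, ipZr) (ipC _ v r).
set a := ip r v; rewrite (_ : _ - _ - _ = ip r r - a ^+ 2 / ip v v); last first.
  by field; exact: lt0r_neq0.
rewrite lerBrDl gerDr pmulr_lle0 ?invr_gt0 // exprn_even_le0 //=.
by move/eqP.
Qed.

Lemma orthoprojP V x : closed_subspace V ->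
  V (orthoproj ip V x) /\ V^! (x - orthoproj ip V x).
Proof.
move=> sV; have [p hp] := orthoproj_exists x sV.
exact: (@xgetPex _ 0 [set p | V p /\ V^! (x - p)]) (ex_intro _ p hp).
Qed.

(** The difference of two candidates lies in V and is also a difference of two vectors orthogonal to
    V, so it is orthogonal to itself. *)
Lemma orthoproj_unique V x p : closed_subspace V ->
  V p -> V^! (x - p) -> orthoproj ip V x = p.
Proof.
move=> sV Vp hp; have [Vq hq] := orthoprojP x sV.
set q := orthoproj ip V x in Vq hq *.
apply/eqP; rewrite -subr_eq0 -normr_eq0 -sqrf_eq0 -(ipxx ip_norm).
have Vqp := closed_subspaceB sV Vq Vp.
have e : x - p - (x - q) = q - p by rewrite opprB addrC addrA subrK.
by rewrite -{1}e ipBl hp // hq // subr0.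
Qed.

Lemma orthoproj_linear V a x y : closed_subspace V ->
  orthoproj ip V (a *: x + y) = a *: orthoproj ip V x + orthoproj ip V y.
Proof.
move=> sV; have [Vx hx] := orthoprojP x sV; have [Vy hy] := orthoprojP y sV.
apply: orthoproj_unique => //; first exact: closed_subspaceZD.
rewrite opprD addrACA -scalerBr => v Vv.
by rewrite ipDl ipZl hx // hy // mulr0 addr0.
Qed.

Lemma orthoprojB V x y : closed_subspace V ->
  orthoproj ip V (x - y) = orthoproj ip V x - orthoproj ip V y.
Proof.
by move=> sV; rewrite addrC -scaleN1r orthoproj_linear // scaleN1r addrC.
Qed.

Lemma orthoproj_id V x : closed_subspace V -> V x -> orthoproj ip V x = x.
Proof.
by move=> sV Vx; apply: orthoproj_unique => // v _; rewrite subrr ip0l.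
Qed.

(** For x in the double complement, x - P_V x is orthogonal to both x and P_V x, hence to itself. *)
Lemma orthocomplK V : closed_subspace V -> V^!^! = V.
Proof.
move=> sV; apply/seteqP; split=> x hx.
  have [Vp hp] := orthoprojP x sV; set p := orthoproj ip V x in Vp hp.
  have /eqP : ip (x - p) (x - p) = 0.
    by rewrite ipBl hx // (ipC _ p) hp // subr0.
  by rewrite (ipxx ip_norm) sqrf_eq0 normr_eq0 subr_eq0 => /eqP->.
by move=> v Vv; rewrite ipC Vv.
Qed.

Lemma orthoproj_orthocompl V x : closed_subspace V ->
  orthoproj ip V^! x = x - orthoproj ip V x.
Proof.
move=> sV; have [Vp hp] := orthoprojP x sV.
apply: orthoproj_unique => //; first exact: closed_subspace_orthocompl.
by rewrite subKr orthocomplK.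
Qed.

End OrthogonalProjection.

(** * Friedrichs angle and its duality under orthogonal complements *)

Section FriedrichsAngle.
Variables (R : realType) (X : completeNormedModType R) (ip : {dot X for idfun}).
Hypothesis ip_norm : induces_norm ip.
Implicit Types (U V : set X) (x y u v w : X) (k : R).
Local Notation "V ^!" := (orthocompl ip V).
Local Notation P := (orthoproj ip).

(** Homogeneous form of c_F <= k for k >= 0; the absolute value costs nothing, since u may be
    replaced by -u. *)
Definition friedrichs_bound U V k := forall u v,
  U u -> (U `&` V)^! u -> V v -> (U `&` V)^! v -> `|ip u v| <= k * (`|u| * `|v|).

(* Bounds the norm of P_{U^perp} on the range of P_{V^perp} P_U. *)
Definition cross_bound U V k := forall y w, U y -> U^! w ->
  `|ip w (y - P V y)| <= k * (`|w| * `|y - P V y|).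

Lemma orthoproj_normB V y : closed_subspace V ->
  `|y - P V y| ^+ 2 = `|y| ^+ 2 - `|P V y| ^+ 2.
Proof.
move=> sV; have [Vp hp] := orthoprojP ip_norm y sV.
rewrite -!(ipxx ip_norm) ipBr (hp _ Vp) subr0 ipBl (ipC _ (P V y)).
by congr (_ - _); apply/eqP; rewrite -subr_eq0 -ipBl hp.
Qed.

(* For y in the orthogonal complement of U `&` V and p = P_V y, replacing p by
   its component p - (|p|/|y|)^2 y orthogonal to y does not change its inner
   product with w. *)
Lemma friedrichs_cross_bound U V k : closed_subspace U -> closed_subspace V ->
  0 <= k -> friedrichs_bound U V k -> cross_bound U V k.
Proof.
move=> sU sV k0 hk y0 w Uy0 Uw.
have sI := closed_subspaceI sU sV.
(* Subtracting z leaves y0 - P_V y0 unchanged, since P_V z = z; this reduces to y orthogonal to the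
   intersection of U and V. *)
have [[Uz Vz] hz] := orthoprojP ip_norm y0 sI; set z := P (U `&` V) y0 in Uz Vz hz.
have eq0 : y0 - P V y0 = (y0 - z) - P V (y0 - z).
  by rewrite orthoprojB // (orthoproj_id ip_norm sV Vz) opprB addrA subrK.
have {Uy0} Uy : U (y0 - z) by exact: closed_subspaceB.
rewrite {}eq0; move: (y0 - z) Uy hz => y Uy Wy {y0 z Uz Vz}.
have [Vp hp] := orthoprojP ip_norm y sV.
have hN := orthoproj_normB y sV.
set p := P V y in Vp hp hN *.
have Wp : (U `&` V)^! p.
  by move=> t [Ut Vt]; rewrite -[p](subKr y) ipBl Wy // hp // subrr.
have hyp : ip y p = `|p| ^+ 2.
  by apply/eqP; rewrite -(ipxx ip_norm) -subr_eq0 -ipBl hp.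
have [y0|y0] := eqVneq y 0.
  have -> : y - p = 0.
    by apply/eqP; rewrite /p y0 orthoproj_id ?subrr //; exact: closed_subspace0.
  by rewrite ip0r !normr0 !mulr0.
have yy : 0 < `|y| ^+ 2 by rewrite exprn_gt0 // normr_gt0.
pose s := `|p| ^+ 2 / `|y| ^+ 2.
have -> : ip w (y - p) = - ip w (p - s *: y).
  by rewrite !ipE Uw // mulr0 subr0 sub0r.
(* The Friedrichs bound for the pair (y, p), where <y,p> = |p|^2, gives |p| <= k |y|, that is s <=
   k^2. *)
have pk : `|p| ^+ 2 <= k ^+ 2 * `|y| ^+ 2.
  have := hk y p Uy Wy Vp Wp; rewrite hyp ger0_norm ?sqr_ge0 // mulrA => h.
  have [->|p0] := eqVneq p 0; first by rewrite normr0 expr0n mulr_ge0 ?sqr_ge0.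
  rewrite -exprMn ler_pXn2r ?nnegrE ?mulr_ge0 //.
  by rewrite -(ler_pM2r (x := `|p|)) ?normr_gt0 // -expr2.
(* Both sides equal |p|^2 - |p|^4 / |y|^2. *)
have ps : `|p - s *: y| ^+ 2 = s * `|y - p| ^+ 2.
  rewrite hN -(ipxx ip_norm) !(ipBl, ipZl) !(ipBr, ipZr) (ipC _ p y) hyp.
  by rewrite !(ipxx ip_norm) /s; field; rewrite normr_eq0.
rewrite normrN; apply: le_trans (CauchySchwarz_norm ip_norm _ _) _.
rewrite mulrCA ler_wpM2l // -(ler_pXn2r (n := 2)) ?nnegrE ?mulr_ge0 // ps exprMn.
by rewrite ler_wpM2r ?sqr_ge0 // /s ler_pdivrMr.
Qed.

(* The range of P_{V^perp} P_U is dense in the part of V^perp orthogonal to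
   U^perp `&` V^perp. *)
Lemma cross_bound_friedrichs U V k : closed_subspace U -> closed_subspace V ->
  0 <= k -> cross_bound U V k -> friedrichs_bound U^! V^! k.
Proof.
move=> sU sV k0 hk w v Uw _ Vv Wv.
have sVc := closed_subspace_orthocompl ip_norm V.
pose D := [set y - P V y | y in U].
have sE : closed_subspace (closure D).
  apply: closed_subspace_closure.
    exists 0; first exact: closed_subspace0.
    by rewrite orthoproj_id ?subrr //; exact: closed_subspace0.
  move=> a _ _ [y Uy <-] [z Uz <-]; exists (a *: y + z); first exact: closed_subspaceZD.
  by rewrite orthoproj_linear // opprD addrACA -scalerBr.
have DV : closure D `<=` V^!.
  case: (sVc) => _ /closure_id ->; apply: closure_subset => _ [y _ <-].
  exact: (orthoprojP ip_norm y sV).2.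
(* The residual v - d is orthogonal to V and to D, hence to every y = (y - P_V y) + P_V y in U. It
   thus lies in both complements, so it is orthogonal to v; being orthogonal to d as well, it
   vanishes. *)
have Dv : closure D v.
  have [Ed he] := orthoprojP ip_norm v sE; set d := P _ v in Ed he.
  suff : ip (v - d) (v - d) = 0.
    by move/eqP; rewrite (ipxx ip_norm) sqrf_eq0 normr_eq0 subr_eq0 => /eqP->.
  have Ve : V^! (v - d) by exact: closed_subspaceB sVc Vv (DV _ Ed).
  rewrite ipBr (he _ Ed) subr0 ipC Wv //; split=> // y Uy.
  rewrite -(subrK (P V y) y) ipDr he ?Ve ?addr0 //.
    exact: (orthoprojP ip_norm y sV).1.
  by apply: subset_closure; exists y.
apply/ler_addgt0Pl => e e0.
(* Replacing v by a nearby q in D costs |w| |v - q| in the inner product and k |w| |v - q| in the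
   bound; the added 1 keeps the divisor positive. *)
have c0 : 0 < (k + 1) * `|w| + 1.
  by rewrite ltr_wpDl // mulr_ge0 // addr_ge0.
move/closure_normP : Dv => /(_ _ (divr_gt0 e0 c0)) [_ [y Uy <-]].
move: (hk y w Uy Uw); set q := y - _ => hq.
rewrite ltr_pdivlMr // => vq.
have h1 : `|ip w v| <= `|ip w q| + `|w| * `|v - q|.
  rewrite -{1}(subrK q v) ipDr addrC; apply: le_trans (ler_normD _ _) _.
  by rewrite lerD2l; exact: CauchySchwarz_norm.
have h2 : `|q| <= `|v| + `|v - q|.
  by rewrite -{1}(subKr v q); exact: ler_normB.
have h3 : k * (`|w| * `|q|) <= k * (`|w| * (`|v| + `|v - q|)).
  by rewrite !ler_wpM2l.
have := normr_ge0 (v - q).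
lra.
Qed.

Lemma cross_friedrichs_bound U V k : closed_subspace U -> closed_subspace V ->
  0 <= k -> cross_bound U V k -> friedrichs_bound U V k.
Proof.
move=> sU sV k0 /(cross_bound_friedrichs sU sV k0) h.
have sUc := closed_subspace_orthocompl ip_norm U.
have sVc := closed_subspace_orthocompl ip_norm V.
have := cross_bound_friedrichs sUc sVc k0 (friedrichs_cross_bound sUc sVc k0 h).
by rewrite !orthocomplK.
Qed.

(** * c_F as the least Friedrichs bound *)

Section CosFriedrichs.
Variables (U V : set X).
Hypotheses (sU : closed_subspace U) (sV : closed_subspace V).
Local Notation c := (cos_friedrichs ip U V).
Let W := (U `&` V)^!.
Let S := [set ip u v | u in [set u | (U `&` W) u /\ `|u| <= 1]
                     & v in [set v | (V `&` W) v /\ `|v| <= 1]].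

Let S0 : S 0.
Proof.
have W0 : W 0 by move=> t _; exact: ip0l.
exists 0; first by rewrite /= normr0; split=> //; split=> //; exact: closed_subspace0.
exists 0; last by rewrite ip0l.
by rewrite /= normr0; split=> //; split=> //; exact: closed_subspace0.
Qed.

Let S1 : ubound S 1.
Proof.
move=> _ [u [_ u1] [v [_ v1] <-]].
apply: le_trans (ler_norm _) _; apply: le_trans (CauchySchwarz_norm ip_norm _ _) _.
by rewrite -[1]mulr1 ler_pM.
Qed.

Lemma cos_friedrichs_ge0 : 0 <= c.
Proof. by apply: ub_le_sup S0; exists 1. Qed.

Lemma cos_friedrichs_le1 : c <= 1.
Proof. by apply: ge_sup S1; exists 0. Qed.

Lemma cos_friedrichs_bound : friedrichs_bound U V c.
Proof.
move=> u v Uu Wu Vv Wv.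
have [->|u0] := eqVneq u 0; first by rewrite ip0l !normr0 mul0r mulr0.
have [->|v0] := eqVneq v 0; first by rewrite ip0r !normr0 !mulr0.
have sW := closed_subspace_orthocompl ip_norm (U `&` V).
have u1 : 0 < `|u| by rewrite normr_gt0.
have v1 : 0 < `|v| by rewrite normr_gt0.
(* The sign a = 1 or -1 is absorbed into the normalized u, so one supremum bounds <u,v> from both
   sides. *)
have key a : `|a| = 1 -> a * ip u v <= c * (`|u| * `|v|).
  move=> a1; rewrite -ler_pdivrMr ?mulr_gt0 //.
  apply: ub_le_sup; first by exists 1.
  exists ((a / `|u|) *: u).
    split; first exact: (conj (closed_subspaceZ _ sU Uu) (closed_subspaceZ _ sW Wu)).
    by rewrite normrZ normrM a1 mul1r normfV normr_id mulVf // lt0r_neq0.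
  exists (`|v|^-1 *: v); last by rewrite !ipE; field; rewrite !lt0r_neq0.
  split; first exact: (conj (closed_subspaceZ _ sV Vv) (closed_subspaceZ _ sW Wv)).
  by rewrite normrZ normfV normr_id mulVf // lt0r_neq0.
rewrite ler_norml; apply/andP; split.
  by rewrite lerNl -mulN1r key // normrN1.
by rewrite -[leLHS]mul1r key // normr1.
Qed.

Lemma cos_friedrichs_min k : 0 <= k -> friedrichs_bound U V k -> c <= k.
Proof.
move=> k0 hk; apply: ge_sup; first by exists 0.
move=> _ [u [[Uu Wu] u1] [v [[Vv Wv] v1] <-]].
apply: le_trans (ler_norm _) _; apply: le_trans (hk u v Uu Wu Vv Wv) _.
by rewrite -[leRHS]mulr1 ler_wpM2l // -[1]mulr1 ler_pM.
Qed.

End CosFriedrichs.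
End FriedrichsAngle.

(** * Scalar inequalities for quadratic forms *)

Section Scalars.
Variable R : realType.
Implicit Types a b d s t : R.

Lemma discriminant_le a b d :
  (forall t, 0 <= a * t ^+ 2 + b - 2 * d * t) -> d ^+ 2 <= a * b.
Proof.
move=> h; have b0 : 0 <= b by have := h 0; rewrite expr0n !mulr0 add0r subr0.
have [d0|d0] := eqVneq d 0.
  rewrite {}d0 in h *; rewrite expr0n mulr_ge0 //; rewrite leNgt; apply/negP => a0.
  (* With d = 0 and a < 0, this argument is large enough to make a t^2 + b negative. *)
  have := h ((b + 1) / - a + 1); set s := (b + 1) / - a.
  have as1 : a * s = - (b + 1) by rewrite /s; field; lra.
  have s0 : 0 <= (b + 1) * s by rewrite /s mulr_ge0 ?divr_ge0 //; lra.
  have -> : a * (s + 1) ^+ 2 + b - 2 * 0 * (s + 1) = (a * s) * (s + 2) + a + b by ring.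
  by rewrite as1; lra.
have [a0|a0] := leP a 0.
  (* Here 2 d t = b + 1 and a t^2 <= 0, so the value is at most -1. *)
  have := h ((b + 1) / (2 * d)); have := sqr_ge0 ((b + 1) / (2 * d)).
  rewrite [X in - X](_ : _ = b + 1); last by field.
  nra.
(* For a > 0 the quadratic is minimal at t = d / a. *)
have := h (d / a); rewrite (_ : _ - _ = (a * b - d ^+ 2) / a); last by field; lra.
by rewrite pmulr_lge0 ?invr_gt0 // subr_ge0.
Qed.

(** A weighted AM-GM inequality: the squares of the two sides differ by (a s^2 - b t^2)^2 + 4 (a b -
    d^2) (s t)^2. *)
Lemma quadratic_form_ge0 a b d s t : 0 <= a -> 0 <= b -> 0 <= s -> 0 <= t ->
  d ^+ 2 <= a * b -> 2 * d * (s * t) <= a * s ^+ 2 + b * t ^+ 2.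
Proof.
move=> a0 b0 s0 t0 h; have q0 : 0 <= a * s ^+ 2 + b * t ^+ 2.
  by rewrite addr_ge0 // mulr_ge0 // sqr_ge0.
apply: le_trans (ler_norm _) _.
rewrite -(ler_pXn2r (n := 2)) ?nnegrE // real_normK ?num_real //.
rewrite -subr_ge0 (_ : _ - _ = (a * s ^+ 2 - b * t ^+ 2) ^+ 2
  + 4 * (a * b - d ^+ 2) * (s * t) ^+ 2); last by ring.
by rewrite addr_ge0 ?sqr_ge0 // mulr_ge0 ?sqr_ge0 // mulr_ge0 // subr_ge0.
Qed.

(** * Admissible values of kappa and the larger root of the quadratic *)

Section LargerRoot.
Variables beta c2 : R.
Hypotheses (beta01 : 0 < beta < 1) (c201 : 0 <= c2 <= 1).

(** Signs of the diagonal coefficients and the discriminant condition for the form in |w| and |q|;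
    [c2] stands for c_F^2. *)
Definition admissible (kappa : R) :=
  [/\ 2^-1 <= kappa, beta <= kappa &
      beta * c2 * (1 - kappa) ^+ 2 <= (kappa - beta) * (2 * kappa - 1)].

Let disc := (1 - 2 * beta) ^+ 2 + 4 * (1 - beta) * beta * c2.
Let root := (1 + 2 * beta * (1 - c2) + Num.sqrt disc) / (2 * (2 - beta * c2)).

Let lead_gt0 : 0 < 2 - beta * c2.
Proof. by case/andP: beta01 c201 => b0 b1 /andP[c0 c1]; nra. Qed.

Let disc_ge0 : 0 <= disc.
Proof.
case/andP: beta01 c201 => b0 b1 /andP[c0 c1].
by rewrite addr_ge0 ?sqr_ge0 // !mulr_ge0 //; lra.
Qed.

(** Derivative of the quadratic (kappa - beta) (2 kappa - 1) - beta c2 (1 - kappa)^2; [linear_sqr]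
    completes the square. *)
Let linear kappa := 2 * (2 - beta * c2) * kappa - (1 + 2 * beta * (1 - c2)).

Let linear_sqr kappa : linear kappa ^+ 2 - disc = 4 * (2 - beta * c2) *
  ((kappa - beta) * (2 * kappa - 1) - beta * c2 * (1 - kappa) ^+ 2).
Proof. by rewrite /linear /disc; ring. Qed.

Let le_root kappa : (kappa <= root) = (linear kappa <= Num.sqrt disc).
Proof. by rewrite /root /linear ler_pdivlMr ?mulr_gt0 // lerBlDl [kappa * _]mulrC. Qed.

Let ge_root kappa : (root <= kappa) = (Num.sqrt disc <= linear kappa).
Proof. by rewrite /root /linear ler_pdivrMr ?mulr_gt0 // lerBrDl [kappa * _]mulrC. Qed.

Lemma larger_root_le kappa : kappa <= 1 -> admissible kappa -> root <= kappa.
Proof.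
case/andP: beta01 c201 => b0 b1 /andP[c0 c1] k1 [k2 kb h].
have lin0 : 0 <= linear kappa.
  (* Each summand is nonnegative for an admissible kappa <= 1, so comparing with the square root
     reduces to comparing squares. *)
  rewrite (_ : linear kappa = (2 * kappa - 1) + 2 * (kappa - beta)
    + 2 * (beta * c2 * (1 - kappa))); last by rewrite /linear; ring.
  have : 0 <= beta * c2 * (1 - kappa) by rewrite !mulr_ge0 //; lra.
  by lra.
rewrite ge_root -(ler_pXn2r (n := 2)) ?nnegrE ?sqrtr_ge0 // sqr_sqrtr //.
by rewrite -subr_ge0 linear_sqr mulr_ge0 ?subr_ge0 // mulr_ge0 // ltW.
Qed.

Let le_root_of_neg kappa :
  (kappa - beta) * (2 * kappa - 1) <= beta * c2 * (1 - kappa) ^+ 2 -> kappa <= root.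
Proof.
move=> h; rewrite le_root; apply: le_trans (ler_norm _) _.
rewrite -sqrtr_sqr ler_wsqrtr // -subr_le0 linear_sqr.
by rewrite mulr_ge0_le0 ?subr_le0 // mulr_ge0 // ltW.
Qed.

(** The quadratic is nonpositive at 1/2 and at beta, so both lie below its larger root, where it
    vanishes. *)
Lemma larger_root_admissible : admissible root.
Proof.
case/andP: beta01 c201 => b0 b1 /andP[c0 c1]; split.
- apply: le_root_of_neg; rewrite mulfV ?pnatr_eq0 // subrr mulr0.
  by rewrite mulr_ge0 ?sqr_ge0 // mulr_ge0 // ltW.
- apply: le_root_of_neg; rewrite subrr mul0r.
  by rewrite mulr_ge0 ?sqr_ge0 // mulr_ge0 // ltW.
- rewrite -subr_ge0 -(pmulr_rge0 _ (_ : 0 < 4 * (2 - beta * c2))) ?mulr_gt0 //.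
  rewrite -linear_sqr (_ : linear root = Num.sqrt disc) ?sqr_sqrtr ?subrr //.
  by apply/le_anti; rewrite -le_root -ge_root lexx.
Qed.

Lemma larger_root_le1 : root <= 1.
Proof.
case/andP: beta01 => b0 b1; apply: larger_root_le => //; split; [lra|lra|].
by rewrite subrr expr0n mulr0; nra.
Qed.

End LargerRoot.
End Scalars.

(** * Averagedness as a norm inequality *)

Section Averaged.
Variables (R : realType) (X : normedModType R).
Implicit Types (T : X -> X) (kappa : R).

Lemma averaged_norm_le T kappa x y : 0 <= kappa -> averaged kappa T ->
  `|T x - T y - (1 - kappa) *: (x - y)| <= kappa * `|x - y|.
Proof.
move=> k0 [N [Nne ->]].
rewrite opprD addrACA -!scalerBr addrAC subrr add0r normrZ ger0_norm //.
by rewrite ler_wpM2l.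
Qed.

(** Solving T = (1 - kappa) Id + kappa N for N leaves one candidate, and the inequality says that it
    is nonexpansive. *)
Lemma norm_le_averaged T kappa : 0 < kappa ->
  (forall x y, `|T x - T y - (1 - kappa) *: (x - y)| <= kappa * `|x - y|) ->
  averaged kappa T.
Proof.
move=> k0 h; exists (fun x => kappa^-1 *: (T x - (1 - kappa) *: x)); split.
  move=> x y; rewrite -scalerBr normrZ gtr0_norm ?invr_gt0 // ler_pdivrMl //.
  by rewrite opprD addrACA -opprD -scalerBr.
by apply/funext => x; rewrite scalerA divff ?lt0r_neq0 // scale1r addrC subrK.
Qed.

Lemma minimum_eq (A : set R) a : A a -> lbound A a -> minimum A = a.
Proof.
move=> Aa lba; have [] := @xgetPex _ 0 (A `&` lbound A) (ex_intro _ a (conj Aa lba)).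
rewrite -/(minimum A) => Am lbm; apply/le_anti.
by rewrite (lbm _ Aa) (lba _ Am).
Qed.

End Averaged.

(** * Averagedness of T is equivalent to admissibility of kappa *)

Section RelaxedReflector.
Variables (R : realType) (X : completeNormedModType R) (ip : {dot X for idfun}).
Hypothesis ip_norm : induces_norm ip.
Variables (U V : set X) (beta : R).
Hypotheses (sU : closed_subspace U) (sV : closed_subspace V).
Hypothesis beta01 : 0 < beta < 1.
Local Notation "V ^!" := (orthocompl ip V).
Local Notation P := (orthoproj ip).
Local Notation cF := (cos_friedrichs ip U V).

Let T (x : X) : X :=
  let y := P U x in (1 - beta) *: y + beta *: reflector ip V y.

Let TE x : T x = P U x - (2 * beta) *: (P U x - P V (P U x)).
Proof.
rewrite /T /reflector orthoproj_orthocompl //; set y := P U x; set p := P V y.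
rewrite scalerBl scale1r -addrA; congr (_ + _).
rewrite -scalerN -scalerDr -[RHS]scalerN mulrC -scalerA; congr (beta *: _).
by rewrite scaler_nat mulr2n !opprB addrA [- y + p]addrC.
Qed.

Let TB x y : T (x - y) = T x - T y.
Proof.
have addrBB (a b c d : X) : a - b - (c - d) = a - c - (b - d).
  by rewrite opprD addrACA -opprD.
by rewrite !TE !orthoprojB // [RHS]addrBB -scalerBr [in RHS]addrBB.
Qed.

(** Square and expand using <w,y> = 0 and <y,q> = |q|^2 for q = y - P_V y; the terms kappa^2 |y|^2
    cancel. *)
Let averaged_form kappa y w : 0 <= kappa -> U y -> U^! w ->
  (`|T (y + w) - (1 - kappa) *: (y + w)| <= kappa * `|y + w|) =
  (0 <= (2 * kappa - 1) * `|w| ^+ 2 + 4 * beta * (kappa - beta) * `|y - P V y| ^+ 2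
    - 4 * beta * (1 - kappa) * ip w (y - P V y)).
Proof.
move=> k0 Uy Uw.
have Py : P U (y + w) = y.
  apply: orthoproj_unique => //; by rewrite addrC addKr.
have [Vp hp] := orthoprojP ip_norm y sV.
rewrite TE Py; move: (P V y) Vp hp => p Vp hp.
rewrite -(ler_pXn2r (n := 2)) ?nnegrE ?mulr_ge0 // exprMn -!(ipxx ip_norm).
have hyw : ip w y = 0 by exact: Uw.
have hq : ip y (y - p) = ip (y - p) (y - p).
  by apply/eqP; rewrite -subr_eq0 -ipBl subKr ipC hp.
have -> : y - (2 * beta) *: (y - p) - (1 - kappa) *: (y + w) =
    kappa *: y - (2 * beta) *: (y - p) - (1 - kappa) *: w.
  rewrite [(1 - kappa) *: (y + w)]scalerDr opprD addrA; congr (_ - _).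
  by rewrite addrAC scalerBl scale1r subKr.
move: (y - p) hq => q hq.
rewrite -[LHS]subr_ge0; congr (0 <= _).
rewrite !ipE (ipC _ q w) (ipC _ y w) (ipC _ q y).
by rewrite hq hyw; ring.
Qed.

Hypotheses (U_proper : U `<` [set: X]) (U_nsub_V : ~ (U `<=` V)).

Let exists_orthocompl_neq0 : exists2 w, U^! w & 0 < `|w|.
Proof.
case: U_proper => _ /existsNP[x /not_implyP[_ Ux]].
have [Up hp] := orthoprojP ip_norm x sU.
exists (x - P U x) => //; rewrite normr_gt0 subr_eq0; apply/eqP => xp.
by apply: Ux; rewrite xp.
Qed.

Let exists_residual_neq0 : exists2 y, U y & 0 < `|y - P V y|.
Proof.
move/existsNP: U_nsub_V => [y /not_implyP[Uy Vy]].
have [Vp hp] := orthoprojP ip_norm y sV.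
exists y => //; rewrite normr_gt0 subr_eq0; apply/eqP => yp.
by apply: Vy; rewrite yp.
Qed.

Lemma averaged_admissible kappa : 0 <= kappa <= 1 -> averaged kappa T ->
  admissible beta (cF ^+ 2) kappa.
Proof.
case/andP: beta01 => b0 b1 /andP[k0 k1] avT.
have form y w : U y -> U^! w ->
    0 <= (2 * kappa - 1) * `|w| ^+ 2 + 4 * beta * (kappa - beta) * `|y - P V y| ^+ 2
      - 4 * beta * (1 - kappa) * ip w (y - P V y).
  move=> Uy Uw; rewrite -averaged_form //.
  have := averaged_norm_le (y + w) 0 k0 avT.
  by rewrite -TB !subr0.
have k2 : 0 <= 2 * kappa - 1.
  (* Taking y = 0 isolates the coefficient of |w|^2; a nonzero w exists because U is proper. *)
  have [w Uw w0] := exists_orthocompl_neq0.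
  have := form 0 w (closed_subspace0 sU) Uw.
  rewrite (orthoproj_id ip_norm sV (closed_subspace0 sV)) subrr normr0 ip0r.
  by rewrite expr0n !mulr0 addr0 subr0 pmulr_lge0 // exprn_gt0.
have kb : 0 <= kappa - beta.
  (* Taking w = 0 isolates the coefficient of |q|^2; a nonzero q exists because U is not contained
     in V. *)
  have [y Uy y0] := exists_residual_neq0.
  have := form y 0 Uy (closed_subspace0 (closed_subspace_orthocompl ip_norm U)).
  rewrite normr0 ip0l expr0n !mulr0 add0r subr0 pmulr_lge0 ?exprn_gt0 //.
  by rewrite pmulr_rge0 // mulr_gt0.
split; [lra|lra|].
have [->|kn1] := eqVneq kappa 1; first by rewrite subrr expr0n mulr0; nra.
have d0 : 0 < beta * (1 - kappa) ^+ 2.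
  by rewrite mulr_gt0 // exprn_gt0 // subr_gt0 lt_neqAle kn1.
(* The largest value of c_F^2 that the third inequality allows; its square root will be shown to be
   a cross bound. *)
pose m := (kappa - beta) * (2 * kappa - 1) / (beta * (1 - kappa) ^+ 2).
have m0 : 0 <= m by apply: divr_ge0; [exact: mulr_ge0|exact: ltW].
suff : cF ^+ 2 <= m by rewrite /m ler_pdivlMr // mulrA [cF ^+ 2 * _]mulrC.
rewrite -(sqr_sqrtr m0) ler_pXn2r ?nnegrE ?sqrtr_ge0 ?cos_friedrichs_ge0 //.
apply: cos_friedrichs_min => //; apply: cross_friedrichs_bound => //.
move=> y w Uy Uw; set q := y - P V y.
(* Scaling w by t turns the form into a quadratic in t that is never negative, so its discriminant
   bounds <w,q>. *)
have : (2 * beta * (1 - kappa) * ip w q) ^+ 2 <=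
    ((2 * kappa - 1) * `|w| ^+ 2) * (4 * beta * (kappa - beta) * `|q| ^+ 2).
  apply: discriminant_le => t.
  have sUc := closed_subspace_orthocompl ip_norm U.
  have := form y (t *: w) Uy (closed_subspaceZ t sUc Uw).
  rewrite -/q normrZ exprMn real_normK ?num_real // ipZl.
  by congr (0 <= _); ring.
move=> h; rewrite -(ler_pXn2r (n := 2)) ?nnegrE ?mulr_ge0 ?sqrtr_ge0 //.
rewrite real_normK ?num_real // !exprMn sqr_sqrtr //.
rewrite /m [leRHS]mulrAC ler_pdivlMr // -(ler_pM2l (x := 4 * beta)) ?mulr_gt0 //.
by move: h; congr (_ <= _); ring.
Qed.

Lemma admissible_averaged kappa : kappa <= 1 -> admissible beta (cF ^+ 2) kappa ->
  averaged kappa T.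
Proof.
case/andP: beta01 => b0 b1 k1 [k2 kb h].
have k0 : 0 < kappa by lra.
apply: norm_le_averaged => // x1 x2; rewrite -TB; move: (x1 - x2) => x.
have [Uy Uw] := orthoprojP ip_norm x sU.
have <- : P U x + (x - P U x) = x by rewrite addrC subrK.
rewrite averaged_form //; last exact: ltW.
move: (P U x) (x - P U x) Uy Uw => y w Uy Uw.
have cb := friedrichs_cross_bound ip_norm sU sV (cos_friedrichs_ge0 ip_norm sU sV)
  (cos_friedrichs_bound ip_norm sU sV) Uy Uw.
set q := y - P V y in cb *.
(* The third admissibility inequality multiplied by 4 beta, which is the discriminant condition once
   <w,q> is bounded by c_F |w| |q|. *)
have hdisc : (2 * beta * (1 - kappa) * cF) ^+ 2 <=
    (2 * kappa - 1) * (4 * beta * (kappa - beta)).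
  rewrite -subr_ge0 (_ : _ - _ = 4 * beta * ((kappa - beta) * (2 * kappa - 1)
    - beta * cF ^+ 2 * (1 - kappa) ^+ 2)); last by ring.
  by rewrite mulr_ge0 ?subr_ge0 // mulr_ge0 // ltW.
have a0 : 0 <= 2 * kappa - 1 by lra.
have d0 : 0 <= 4 * beta * (kappa - beta) by rewrite mulr_ge0 ?mulr_ge0 //; lra.
have qf := quadratic_form_ge0 a0 d0 (normr_ge0 w) (normr_ge0 q) hdisc.
rewrite subr_ge0; apply: le_trans qf.
rewrite (_ : 2 * _ * _ = 4 * beta * (1 - kappa) * (cF * (`|w| * `|q|))); last by ring.
rewrite ler_wpM2l //; last exact: le_trans (ler_norm _) cb.
by rewrite mulr_ge0 ?mulr_ge0 //; lra.
Qed.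

End RelaxedReflector.

Theorem theorem3p2 (R : realType) (X : completeNormedModType R)
    (ip : {dot X for idfun}) (ip_norm : induces_norm ip)
    (U V : set X) (U_closed : closed_subspace U) (V_closed : closed_subspace V)
    (beta : R) (beta01 : 0 < beta < 1)
    (U_proper : U `<` [set: X]) (U_nsub_V : ~ (U `<=` V)) :
  let T := fun x : X =>
    let y := orthoproj ip U x in
    (1 - beta) *: y + beta *: reflector ip V y in
  let cF := cos_friedrichs ip U V in
  modulus_averagedness T =
    (1 + 2 * beta * (1 - cF ^+ 2)
       + Num.sqrt ((1 - 2 * beta) ^+ 2 + 4 * (1 - beta) * beta * cF ^+ 2))
    / (2 * (2 - beta * cF ^+ 2)).
Proof.
have c0 := cos_friedrichs_ge0 ip_norm U_closed V_closed.
have c1 := cos_friedrichs_le1 ip_norm U_closed V_closed.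
have c201 : 0 <= cos_friedrichs ip U V ^+ 2 <= 1.
  by rewrite sqr_ge0 exprn_ile1.
have adm := larger_root_admissible beta01 c201.
have le1 := larger_root_le1 beta01 c201.
(* The larger root belongs to the set of averagedness constants and bounds it from below, so the
   minimum is attained there. *)
apply: minimum_eq.
  split; last exact: admissible_averaged.
  by rewrite le1 andbT; case: adm => h _ _; apply: le_trans h; rewrite invr_ge0.
move=> kappa [k01 avT]; apply: larger_root_le => //; first by case/andP: k01.
exact: averaged_admissible avT.
Qed.
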